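(* Let $\mathfrak{h}_3$ be the Lie algebra of the $3$-dimensional Heisenberg group $\mathbb{H}_3$, with basis $\{X_1,X_2,X_3\}$ satisfying $[X_1,X_2]=X_3$, $[X_1,X_3]=[X_2,X_3]=0$. Let $H$ be the connected Lie subgroup of $\mathbb{H}_3$ with Lie algebra $\mathbb{R}\{X_2\}$. The nilpotent symmetric space $\mathbb{H}_3/H$ associated with the $\mathbb{Z}_2$-grading $$\mathfrak{h}_3=\mathbb{R}\{X_2\}\oplus\mathbb{R}\{X_1,X_3\}$$ does not admit any pseudo-Riemannian symmetric metric.
   Context: $\mathbb{H}_3$ is the group of real upper triangular unipotent $3\times3$ matrices. In the $\mathbb{Z}_2$-grading $\mathfrak{g}=\mathfrak{g}_0\oplus\mathfrak{g}_1$, the first summand $\mathfrak{g}_0$ is the Lie algebra of $H$. A pseudo-Riemannian symmetric metric on the symmetric space $G/H$ ($G$, $H$ connected) associated with a $\mathbb{Z}_2$-grading $\mathfrak{g}=\mathfrak{g}_0\oplus\mathfrak{g}_1$ is a $G$-invariant pseudo-Riemannian metric; such metrics correspond to non-degenerate symmetric bilinear forms $B$ on $\mathfrak{g}_1$ that are $\mathrm{ad}(\mathfrak{g}_0)$-invariant, i.e. $B([Z,X],Y)+B(X,[Z,Y])=0$ for all $X,Y\in\mathfrak{g}_1$, $Z\in\mathfrak{g}_0$. *)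

(* Defs.v *)
From HB Require Import structures.
From mathcomp Require Import all_boot all_order all_algebra.
From mathcomp Require Import all_classical all_reals all_analysis.
From mathcomp Require Import ring.

Set Implicit Arguments.
Unset Strict Implicit.
Unset Printing Implicit Defensive.

Import Order.TTheory GRing.Theory Num.Theory.
Import numFieldNormedType.Exports.

Local Open Scope classical_set_scope.
Local Open Scope ring_scope.

Section MatrixGroups.
Variables (R : realType) (n : nat).
Implicit Types (A B X Y : 'M[R]_n.+1) (G H S : set 'M[R]_n.+1).

Definition bracket X Y : 'M[R]_n.+1 := X *m Y - Y *m X.

(* The exponential of a nilpotent X: then X ^+ n.+1 = 0, so that the
   exponential series stops at k = n.  Only used for nilpotent matrices. *)
Definition nilp_exp X : 'M[R]_n.+1 := \sum_(k < n.+1) k`!%:R^-1 *: X ^+ k.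

Definition is_subgroup S : Prop :=
  [/\ S 1%:M,
      forall A B, S A -> S B -> S (A *m B) &
      forall A, S A -> S (invmx A)].

(* The connected Lie subgroup with a given (nilpotent) Lie algebra h is the
   subgroup generated by exp h. *)
Definition connected_subgroup (h : {vspace 'M[R]_n.+1}) : set 'M[R]_n.+1 :=
  smallest is_subgroup (nilp_exp @` [set` h]).

Definition ltranslate A S : set 'M[R]_n.+1 := (fun B => A *m B) @` S.

Definition cosets G H : set (set 'M[R]_n.+1) :=
  [set ltranslate A H | A in G].

Definition Z2_grading (g g0 g1 : {vspace 'M[R]_n.+1}) : Prop :=
  [/\ (g0 + g1 = g)%VS /\ directv (g0 + g1)%VS,
      forall X Y, X \in g0 -> Y \in g0 -> bracket X Y \in g0,
      forall X Y, X \in g0 -> Y \in g1 -> bracket X Y \in g1 &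
      forall X Y, X \in g1 -> Y \in g1 -> bracket X Y \in g0].

(* p |-> exp (\sum_i p_i e_i) H, for e a basis of the odd part g1 of a grading
   g = g0 + g1 and H the connected subgroup with Lie algebra g0.  For G a
   simply connected nilpotent group this is a global chart of the manifold
   G/H; see heis_chart_bij and heis_chart_proj below for the Heisenberg
   group. *)
Definition chart (g0 : {vspace 'M[R]_n.+1}) (m : nat)
    (e : m.-tuple 'M[R]_n.+1) (p : 'rV[R]_m) : set 'M[R]_n.+1 :=
  ltranslate (nilp_exp (\sum_(i < m) p 0 i *: tnth e i))
             (connected_subgroup g0).

End MatrixGroups.

Section Metrics.
Variables (R : realType) (m : nat).

(* f is C^oo: all its iterated partial derivatives are differentiable. *)
Definition smooth (f : 'rV[R]_m -> R) : Prop :=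
  forall (s : seq 'I_m) (x : 'rV[R]_m),
    differentiable
      (foldr (fun i (h : 'rV[R]_m -> R) => 'D_(delta_mx 0 i) h) f s) x.

Definition bilin (B : 'M[R]_m) (u v : 'rV[R]_m) : R := (u *m B *m v^T) 0 0.

(* gamma p is the Gram matrix of the metric on the tangent space R^m at p. *)
Definition pseudo_riemannian_metric (gamma : 'rV[R]_m -> 'M[R]_m) : Prop :=
  [/\ forall i j, smooth (fun p => gamma p i j),
      forall p, (gamma p)^T = gamma p &
      forall p, gamma p \in unitmx].

(* tau is the expression in the chart of the left translation of G/H by A, and
   the metric is required to be preserved by all such translations. *)
Definition invariant_metric (n : nat) (G : set 'M[R]_n.+1)
    (phi : 'rV[R]_m -> set 'M[R]_n.+1) (gamma : 'rV[R]_m -> 'M[R]_m) : Prop :=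
  forall (A : 'M[R]_n.+1) (tau : 'rV[R]_m -> 'rV[R]_m),
    G A -> (forall p, phi (tau p) = ltranslate A (phi p)) ->
    forall p u v : 'rV[R]_m,
      bilin (gamma (tau p)) ('d tau p u) ('d tau p v) = bilin (gamma p) u v.

End Metrics.

(* The symmetric space G/H attached to g = g0 + g1 admits a pseudo-Riemannian
   symmetric metric, i.e. a G-invariant pseudo-Riemannian metric, written in
   the global chart given by a basis e of g1.  Another choice of e changes the
   chart by a linear automorphism of R^m. *)
Definition admits_symmetric_metric (R : realType) (n : nat)
    (G : set 'M[R]_n.+1) (g0 g1 : {vspace 'M[R]_n.+1}) : Prop :=
  exists (m : nat) (e : m.-tuple 'M[R]_n.+1) (gamma : 'rV[R]_m -> 'M[R]_m),
    [/\ basis_of g1 e,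
        pseudo_riemannian_metric gamma &
        invariant_metric G (chart g0 e) gamma].

Definition heis_group (R : realType) : set 'M[R]_3 :=
  [set A | forall i j : 'I_3, (j <= i)%N -> A i j = (i == j)%:R].

Definition heis_lie (R : realType) : {vspace 'M[R]_3} :=
  <<[:: delta_mx 0%R 1%R; delta_mx 1%R 2%:R; delta_mx 0%R 2%:R]>>%VS.

Definition heis_basis (R : realType) (X1 X2 X3 : 'M[R]_3) : Prop :=
  [/\ basis_of (heis_lie R) [:: X1; X2; X3],
      bracket X1 X2 = X3, bracket X1 X3 = 0 & bracket X2 X3 = 0].

Section Heisenberg.
Variable R : realType.
Implicit Types (a b c : R) (X Y Z : 'M[R]_3).

Let M a b c : 'M[R]_3 :=
  a *: delta_mx 0 1 + b *: delta_mx 1 2%:R + c *: delta_mx 0 2%:R.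

Lemma heis_lieP X : reflect (exists a b c, X = M a b c) (X \in heis_lie R).
Proof.
rewrite /heis_lie !span_cons span_nil addv0.
apply: (iffP idP).
  move=> /memv_addP[_ /vlineP[a ->] [_ /memv_addP[_ /vlineP[b ->]
    [_ /vlineP[c ->] ->]] ->]].
  by exists a, b, c; rewrite /M addrA.
move=> [a [b [c ->]]]; rewrite /M -addrA.
by rewrite memv_add ?memv_add ?memvZ ?memv_line.
Qed.

Let mul2 a b c a' b' c' : M a b c *m M a' b' c' = M 0 0 (a * b').
Proof.
rewrite /M !mulmxDl !mulmxDr -!scalemxAl -!scalemxAr !mul_delta_mx_cond /=.
by rewrite !mulr0n !scaler0 !scale0r !addr0 !add0r mulr1n scalerA.
Qed.

Let exp2 X : X \in heis_lie R ->
  nilp_exp X = 1%:M + X + 2^-1 *: (X *m X).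
Proof.
move=> _; rewrite /nilp_exp !big_ord_recl big_ord0 /= expr0 expr1 expr2.
by rewrite !invr1 !scale1r addr0 addrA.
Qed.

Lemma heis_bracketE a b c a' b' c' :
  bracket (M a b c) (M a' b' c') = M 0 0 (a * b' - a' * b).
Proof. by rewrite /bracket !mul2 /M !scale0r !add0r scalerBl. Qed.

Let expM a b c : nilp_exp (M a b c) = 1%:M + M a b (c + 2^-1 * (a * b)).
Proof.
rewrite exp2; last by apply/heis_lieP; exists a, b, c.
by rewrite mul2 /M !scale0r !add0r scalerA [in RHS]scalerDl !addrA.
Qed.

Let MD a b c a' b' c' : M a b c + M a' b' c' = M (a + a') (b + b') (c + c').
Proof. by apply/matrixP => i j; rewrite /M !mxE; ring. Qed.
Let MZ k a b c : k *: M a b c = M (k * a) (k * b) (k * c).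
Proof. by rewrite /M !scalerDr !scalerA. Qed.

Lemma heis_expM X Y : X \in heis_lie R -> Y \in heis_lie R ->
  nilp_exp X *m nilp_exp Y = nilp_exp (X + Y + 2^-1 *: bracket X Y).
Proof.
move=> /heis_lieP[a [b [c ->]]] /heis_lieP[a' [b' [c' ->]]].
rewrite heis_bracketE MZ !MD !expM mulmxDl mul1mx mulmxDr mulmx1 mul2.
rewrite MD -addrA MD; congr (_ + _).
by congr (M _ _ _); field.
Qed.


Lemma heis_exp_inj : {in heis_lie R &, injective (@nilp_exp R 2)}.
Proof.
move=> _ _ /heis_lieP[a [b [c ->]]] /heis_lieP[a' [b' [c' ->]]].
rewrite !expM => /addrI /matrixP e.
have ea : a = a' by have := e 0 1; rewrite /M !mxE /= !(mulr1, mulr0, addr0).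
have eb : b = b'.
  by have := e 1 2%:R; rewrite /M !mxE /= !(mulr1, mulr0, addr0, add0r).
have := e 0 2%:R; rewrite /M !mxE /= !(mulr1, mulr0, addr0, add0r) ea eb.
by move/addIr ->.
Qed.

Lemma heis_exp_range : @nilp_exp R 2 @` [set` heis_lie R] = @heis_group R.
Proof.
apply/seteqP; split => [_ [_ /heis_lieP[a [b [c ->]]] <-]|A hA].
  rewrite expM => -[[|[|[|//]]] hi] [[|[|[|//]]] hj] //= _;
  by rewrite /M !mxE /= !(mulr1, mulr0, addr0, add0r).
exists (M (A 0 1) (A 1 2%:R) (A 0 2%:R - 2^-1 * (A 0 1 * A 1 2%:R))).
  by apply/heis_lieP; do 3 eexists.
rewrite expM subrK; apply/matrixP => i j; rewrite /M !mxE.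
have [ji|ij] := leqP j i; last first.
  by case: i j ij => [[|[|[|//]]] hi] [[|[|[|//]]] hj] //= _;
    rewrite !(mulr1, mulr0, addr0, add0r); congr (fun_of_matrix A _ _); exact: val_inj.
rewrite (hA i j ji); move: ji => {hA}.
by case: i j => [[|[|[|//]]] hi] [[|[|[|//]]] hj] //= _;
  rewrite !(mulr1, mulr0, addr0, add0r).
Qed.

Section Basis.
Variables X1 X2 X3 : 'M[R]_3.
Hypothesis hX : heis_basis X1 X2 X3.

Let L a b c : 'M[R]_3 := a *: X1 + b *: X2 + c *: X3.

Let X_heis : [/\ X1 \in heis_lie R, X2 \in heis_lie R & X3 \in heis_lie R].
Proof.
by case: hX => hb _ _ _; split; apply: (basis_mem hb); rewrite !inE eqxx ?orbT.
Qed.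

Let L_heis a b c : L a b c \in heis_lie R.
Proof. by case: X_heis => *; rewrite !memvD ?memvZ. Qed.

Let L_surj Y : Y \in heis_lie R -> exists a b c, Y = L a b c.
Proof.
case: hX => /andP[/eqP <- _] _ _ _.
rewrite !span_cons span_nil addv0.
move=> /memv_addP[_ /vlineP[a ->] [_ /memv_addP[_ /vlineP[b ->]
    [_ /vlineP[c ->] ->]] ->]].
by exists a, b, c; rewrite /L addrA.
Qed.

Let L_inj a b c a' b' c' : L a b c = L a' b' c' -> [/\ a = a', b = b' & c = c'].
Proof.
case: hX => /andP[_ fr] _ _ _ /eqP; rewrite -subr_eq0 => /eqP e.
have fr' := freeP (X := [tuple X1; X2; X3]) fr.
have := fr' (fun i => [:: a - a'; b - b'; c - c']`_i).
rewrite !big_ord_recl big_ord0 /= => /(_ _) h.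
have {}h : forall i : 'I_3, [:: a - a'; b - b'; c - c']`_i = 0.
  by apply: h; rewrite -{}[RHS]e /L; apply/matrixP => i j; rewrite !mxE; ring.
by split; apply/eqP; rewrite -subr_eq0; apply/eqP;
  [exact: (h 0)|exact: (h 1)|exact: (h 2%:R)].
Qed.

Let bracketL a b c a' b' c' :
  bracket (L a b c) (L a' b' c') = L 0 0 (a * b' - a' * b).
Proof.
case: hX => _ h12 h13 h23.
have -> : bracket (L a b c) (L a' b' c') =
    (a * b' - a' * b) *: bracket X1 X2 + (a * c' - a' * c) *: bracket X1 X3
    + (b * c' - b' * c) *: bracket X2 X3.
  rewrite /bracket /L !mulmxDl !mulmxDr -!scalemxAl -!scalemxAr.
  by apply/matrixP => i j; rewrite !mxE; ring.
by rewrite h12 h13 h23 /L !scaler0 !scale0r !addr0 !add0r.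
Qed.

Let expLM a b c a' b' c' :
  nilp_exp (L a b c) *m nilp_exp (L a' b' c') =
  nilp_exp (L (a + a') (b + b') (c + c' + 2^-1 * (a * b' - a' * b))).
Proof.
rewrite heis_expM // bracketL; congr nilp_exp.
by rewrite /L; apply/matrixP => i j; rewrite !mxE; ring.
Qed.

Let exp0 : nilp_exp (0 : 'M[R]_3) = 1%:M.
Proof. by rewrite exp2 ?mem0v // mulmx0 scaler0 !addr0. Qed.

Lemma heis_grading :
  Z2_grading (heis_lie R) <[X2]>%VS (<[X1]> + <[X3]>)%VS.
Proof.
have in1 Y : Y \in (<[X1]> + <[X3]>)%VS -> exists a c, Y = L a 0 c.
  move=> /memv_addP[_ /vlineP[a ->] [_ /vlineP[c ->] ->]].
  by exists a, c; rewrite /L scale0r addr0.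
have in2 Y : Y \in <[X2]>%VS -> exists b, Y = L 0 b 0.
  by move=> /vlineP[b ->]; exists b; rewrite /L !scale0r addr0 add0r.
split; first split.
- case: hX => /andP[/eqP <- _] _ _ _.
  by rewrite !span_cons span_nil addv0 !addvA [(<[X2]> + _)%VS]addvC.
- apply/directv_addP/eqP; rewrite -subv0; apply/subvP => Y.
  rewrite memv_cap memv0 => /andP[/in2[b ->] /in1[a [c /L_inj[_ -> _]]]].
  by rewrite /L !scale0r !addr0.
- by move=> _ _ /in2[b ->] /in2[b' ->]; rewrite bracketL !(mulr0, mul0r) subr0
    /L !scale0r !addr0 mem0v.
- move=> _ _ /in2[b ->] /in1[a [c ->]]; rewrite bracketL /L !scale0r !add0r.
  by rewrite memvZ // (subvP (addvSr _ _)) // memv_line.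
- by move=> _ _ /in1[a [c ->]] /in1[a' [c' ->]];
    rewrite bracketL !(mulr0, mul0r) subr0 /L !scale0r !addr0 mem0v.
Qed.

Lemma heis_subgroupE :
  connected_subgroup <[X2]>%VS = range (fun t : R => nilp_exp (t *: X2)).
Proof.
have LE t : t *: X2 = L 0 t 0 by rewrite /L !scale0r add0r addr0.
apply/seteqP; split; last first.
  by move=> _ [t _ <-] S [_]; apply; exists (t *: X2) => //=;
    rewrite memvZ // memv_line.
apply: smallest_sub; last first.
  by move=> _ [_ /vlineP[t ->] <-]; exists t.
have expD s t : nilp_exp (s *: X2) *m nilp_exp (t *: X2) =
    nilp_exp ((s + t) *: X2).
  by rewrite !LE expLM !(mul0r, mulr0, subr0, addr0).
split.
- by exists 0 => //; rewrite scale0r exp0.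
- by move=> _ _ [s _ <-] [t _ <-]; exists (s + t).
- move=> _ [t _ <-]; exists (- t) => //.
  have e : nilp_exp (t *: X2) *m nilp_exp (- t *: X2) = 1%:M.
    by rewrite expD subrr scale0r exp0.
  have [u _] := mulmx1_unit e.
  by rewrite -[LHS](mulKmx u) e mulmx1.
Qed.

Let chartE (p : 'rV[R]_2) : chart <[X2]>%VS [tuple X1; X3] p =
  range (fun t => nilp_exp (L (p 0 0) t (p 0 1 + 2^-1 * (p 0 0 * t)))).
Proof.
have e t : nilp_exp (\sum_(i < 2) p 0 i *: tnth [tuple X1; X3] i)
    *m nilp_exp (t *: X2) = nilp_exp (L (p 0 0) t (p 0 1 + 2^-1 * (p 0 0 * t))).
  have -> : \sum_(i < 2) p 0 i *: tnth [tuple X1; X3] i = L (p 0 0) 0 (p 0 1).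
    rewrite !big_ord_recl big_ord0 /= addr0 /L scale0r addr0.
    by congr (_ + _ *: _); congr (fun_of_matrix p _ _); exact: val_inj.
  have -> : t *: X2 = L 0 t 0 by rewrite /L !scale0r add0r addr0.
  by rewrite expLM !(mul0r, mulr0, subr0, addr0, add0r).
rewrite /chart /ltranslate heis_subgroupE; apply/seteqP; split.
  by move=> _ [_ [t _ <-] <-]; exists t.
by move=> _ [t _ <-]; exists (nilp_exp (t *: X2)); first exists t.
Qed.

(* The projection of the group onto its coset space, read in exponential
   coordinates and in the chart, is (a, b, c) |-> (a, c - ab/2): a surjective
   submersion, so the chart induces the quotient manifold structure. *)
Lemma heis_chart_proj (a b c : R) :
  ltranslate (nilp_exp (a *: X1 + b *: X2 + c *: X3))
             (connected_subgroup <[X2]>%VS) =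
  chart <[X2]>%VS [tuple X1; X3]
        (\row_(i < 2) if i == 0 then a else c - 2^-1 * (a * b)).
Proof.
rewrite chartE !mxE /= /ltranslate heis_subgroupE.
have e t : nilp_exp (L a b c) *m nilp_exp (t *: X2) =
    nilp_exp (L a (b + t) (c - 2^-1 * (a * b) + 2^-1 * (a * (b + t)))).
  have -> : t *: X2 = L 0 t 0 by rewrite /L !scale0r add0r addr0.
  by rewrite expLM; congr (nilp_exp (L _ _ _)); ring.
apply/seteqP; split.
  by move=> _ [_ [t _ <-] <-]; exists (b + t) => //; rewrite -e.
move=> _ [t _ <-]; exists (nilp_exp ((t - b) *: X2)); first by exists (t - b).
by rewrite e addrC subrK.
Qed.

Lemma heis_even_basis : basis_of (<[X1]> + <[X3]>)%VS [tuple X1; X3].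
Proof.
rewrite /basis_of !span_cons span_nil addv0 eqxx /=.
apply/(@freeP _ _ 2 [tuple X1; X3]) => k.
rewrite !big_ord_recl big_ord0 addr0 /= => h.
have /L_inj[h0 _ h1] : L (k ord0) 0 (k (lift ord0 ord0)) = L 0 0 0.
  by rewrite /L !scale0r !addr0.
case=> [[|[|//]] hi]; [rewrite -[RHS]h0|rewrite -[RHS]h1];
  by congr k; exact: val_inj.
Qed.

Lemma heis_chart_bij :
  set_bij [set: 'rV[R]_2]
          (cosets (@heis_group R) (connected_subgroup <[X2]>%VS))
          (chart <[X2]>%VS [tuple X1; X3]).
Proof.
split.
- move=> p _; exists (nilp_exp (L (p 0 0) 0 (p 0 1))).
    by rewrite -heis_exp_range; exists (L (p 0 0) 0 (p 0 1)) => //=.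
  rewrite heis_chart_proj; congr (chart _ _ _); apply/rowP => i.
  rewrite !mxE !mulr0 subr0; case: ifPn => [/eqP -> //|].
  by case: i => [[|[|//]] hi] //= _; congr (fun_of_matrix p _ _); exact: val_inj.
- move=> p q _ _ e.
  have : chart <[X2]>%VS [tuple X1; X3] p
    (nilp_exp (L (p 0 0) 0 (p 0 1))).
    by rewrite chartE; exists 0 => //; rewrite !mulr0 addr0.
  rewrite e chartE => -[t _ /heis_exp_inj].
  move=> /(_ (L_heis _ _ _) (L_heis _ _ _)) /L_inj[h0 ht h1].
  apply/rowP => i; case: i => [[|[|//]] hi].
    by rewrite (_ : Ordinal hi = 0) //; exact: val_inj.
  rewrite (_ : Ordinal hi = 1); last exact: val_inj.
  by move: h1; rewrite ht !mulr0 addr0.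
- move=> C [A]; rewrite -heis_exp_range => -[Y hY <-] <-.
  have [a [b [c ->]]] := L_surj hY.
  by rewrite heis_chart_proj; eexists.
Qed.

End Basis.

End Heisenberg.

(* Main.v *)
Require Import Defs.
From mathcomp Require Import all_boot all_order all_algebra.
From mathcomp Require Import all_classical all_reals all_analysis.

Set Implicit Arguments.
Unset Strict Implicit.
Unset Printing Implicit Defensive.

Import GRing.Theory Num.Theory.
Import numFieldNormedType.Exports.
Local Open Scope ring_scope.

(** The isotropy group [H] fixes the base point of [G/H], so an invariant
    metric restricts there to a form [B] on [g1] for which the isotropy
    representation is isometric.  For the Heisenberg group, [exp X2] acts on
    [g1 = <X1, X3>] by the unipotent map [1 + ad X2], which sends [X1] to
    [X1 - X3] and fixes [X3].  Preservation of [B (X1, X3)] and [B (X1, X1)]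
    then forces [B (X3, X3) = 0] and [B (X1, X3) = 0]
    ([unipotent_isometry_orth]), so [X3] lies in the radical of [B],
    contradicting non-degeneracy.

    To reach this from a metric given in the chart [p |-> exp (p . e) H], it is
    enough to see that in the chart the left translation by [exp X2] is the
    linear map [p |-> p *m (1 + N)], with [N] the matrix of [ad X2] on [g1]
    ([chart_isotropy]); such a map is its own differential ([diff_mulmxr]). *)

Lemma mulmxr_continuous (R : realType) (m n : nat) (T : 'M[R]_(m, n)) :
  continuous (fun p : 'rV[R]_m => p *m T).
Proof.
have -> : (fun p : 'rV[R]_m => p *m T) = fun p => \sum_i p 0 i *: row i T.
  by apply/funext => p; exact: mulmx_sum_row.
apply: continuous_big => [|i _ p]; first exact: add_continuous.
apply: (@continuous_comp _ _ _ (fun q : 'rV[R]_m => q 0 i) ( *:%R^~ (row i T))).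
  exact: coord_continuous.
exact: scalel_continuous.
Qed.

Lemma diff_mulmxr (R : realType) (m n : nat) (T : 'M[R]_(m, n))
    (p u : 'rV[R]_m) :
  'd (fun q : 'rV[R]_m => q *m T) p u = u *m T.
Proof.
by rewrite (@diff_lin _ _ _ (mulmxr T)) //; exact: mulmxr_continuous.
Qed.

Section Bilin.
Variables (R : realType) (m : nat) (B : 'M[R]_m).
Implicit Types u v w : 'rV[R]_m.

Lemma bilinDl u v w : bilin B (u + v) w = bilin B u w + bilin B v w.
Proof. by rewrite /bilin !mulmxDl mxE. Qed.

Lemma bilinDr u v w : bilin B u (v + w) = bilin B u v + bilin B u w.
Proof. by rewrite /bilin linearD mulmxDr mxE. Qed.

Lemma bilinZr a u v : bilin B u (a *: v) = a * bilin B u v.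
Proof. by rewrite /bilin linearZ -scalemxAr mxE. Qed.

Lemma bilinC u v : B^T = B -> bilin B u v = bilin B v u.
Proof.
by move=> sB; rewrite /bilin -[in LHS](trmxK (u *m B *m v^T)) mxE
  !trmx_mul trmxK sB mulmxA.
Qed.

Lemma bilin_nondegenerate u :
  B \in unitmx -> (forall v, bilin B u v = 0) -> u = 0.
Proof.
move=> uB u0; apply: (can_inj (mulmxK uB)); rewrite mul0mx.
apply/rowP => j; rewrite [RHS]mxE -(u0 (delta_mx 0 j)) /bilin.
by rewrite trmx_delta -colE [RHS]mxE.
Qed.

(** With [w = u *m N], the isometry fixes [w] and moves [u] to [u + w]:
    preserving the pairing of [u] with [w] gives [B (w, w) = 0], after which
    preserving the square of [u] gives [2 B (w, u) = 0]. *)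
Lemma unipotent_isometry_orth (N : 'M[R]_m) u : B^T = B ->
  (forall x y, bilin B (x *m (1%:M + N)) (y *m (1%:M + N)) = bilin B x y) ->
  u *m N *m N = 0 ->
  bilin B (u *m N) u = 0 /\ bilin B (u *m N) (u *m N) = 0.
Proof.
move=> sB iso; set w := u *m N => wN.
have eu : u *m (1%:M + N) = u + w by rewrite mulmxDr mulmx1.
have ew : w *m (1%:M + N) = w by rewrite mulmxDr mulmx1 wN addr0.
have ww : bilin B w w = 0.
  have := iso u w; rewrite eu ew bilinDl => /eqP.
  by rewrite -subr_eq0 addrC addKr => /eqP.
split=> //; have := iso u u.
rewrite eu bilinDl !bilinDr ww addr0 (bilinC u w) // -addrA => /eqP.
rewrite -subr_eq0 addrAC subrr add0r -mulr2n -mulr_natr mulf_eq0 pnatr_eq0 orbF.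
by move/eqP.
Qed.

End Bilin.

Lemma bracketC (R : realType) n (X Y : 'M[R]_n.+1) :
  bracket X Y = - bracket Y X.
Proof. by rewrite /bracket opprB. Qed.

Lemma bracketDr (R : realType) n (X Y Z : 'M[R]_n.+1) :
  bracket X (Y + Z) = bracket X Y + bracket X Z.
Proof. by rewrite /bracket mulmxDl mulmxDr opprD addrACA. Qed.

Lemma bracketZr (R : realType) n a (X Y : 'M[R]_n.+1) :
  bracket X (a *: Y) = a *: bracket X Y.
Proof. by rewrite /bracket -scalemxAl -scalemxAr scalerBr. Qed.

Lemma bracket_sumr (R : realType) n (X : 'M[R]_n.+1) (I : finType)
    (F : I -> 'M[R]_n.+1) :
  bracket X (\sum_i F i) = \sum_i bracket X (F i).
Proof. by rewrite /bracket mulmx_sumr mulmx_suml -sumrB. Qed.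

Section Frame.
Variables (R : realType) (n m : nat) (e : m.-tuple 'M[R]_n.+1).

Definition frame (p : 'rV[R]_m) : 'M[R]_n.+1 :=
  \sum_(i < m) p 0 i *: tnth e i.

Definition coords (Y : 'M[R]_n.+1) : 'rV[R]_m := \row_i coord e i Y.

Definition ad_mx (X : 'M[R]_n.+1) : 'M[R]_m :=
  \matrix_i coords (bracket X (tnth e i)).

Lemma frameD p q : frame (p + q) = frame p + frame q.
Proof. by rewrite -big_split; apply: eq_bigr => i _; rewrite mxE scalerDl. Qed.

Lemma frameZ a p : frame (a *: p) = a *: frame p.
Proof. by rewrite scaler_sumr; apply: eq_bigr => i _; rewrite mxE scalerA. Qed.

Lemma frame0 : frame 0 = 0.
Proof. by apply: big1 => i _; rewrite mxE scale0r. Qed.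

Lemma frame_sum (I : finType) (F : I -> 'rV[R]_m) :
  frame (\sum_i F i) = \sum_i frame (F i).
Proof. exact: (big_morph frame frameD frame0). Qed.

Variable g : {vspace 'M[R]_n.+1}.
Hypothesis be : basis_of g e.

Lemma frame_mem p : frame p \in g.
Proof.
by apply: memv_suml => i _; rewrite memvZ // (basis_mem be) // mem_tnth.
Qed.

Lemma coordsK Y : Y \in g -> frame (coords Y) = Y.
Proof.
move=> gY; rewrite [RHS](coord_basis be gY); apply: eq_bigr => i _.
by rewrite mxE (tnth_nth 0).
Qed.

Lemma frame_inj : injective frame.
Proof.
move=> p q /eqP; rewrite -subr_eq0 -scaleN1r -frameZ -frameD => /eqP h.
apply/eqP; rewrite -subr_eq0 -scaleN1r; apply/eqP/rowP => i.
rewrite [RHS]mxE; move: i.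
apply: (elimT freeP (basis_free be) (fun i => (p + -1 *: q) 0 i)).
by rewrite -[RHS]h; apply: eq_bigr => j _; rewrite (tnth_nth 0).
Qed.

Lemma ad_mxP X p : (forall Y, Y \in g -> bracket X Y \in g) ->
  frame (p *m ad_mx X) = bracket X (frame p).
Proof.
move=> adX; rewrite mulmx_sum_row frame_sum bracket_sumr.
apply: eq_bigr => i _; rewrite frameZ rowK bracketZr coordsK //.
by rewrite adX // (basis_mem be) // mem_tnth.
Qed.

End Frame.

Section HeisenbergIsotropy.
Variables (R : realType) (X1 X2 X3 : 'M[R]_3).
Hypothesis hX : heis_basis X1 X2 X3.

Lemma heis_basis_mem :
  [/\ X1 \in heis_lie R, X2 \in heis_lie R & X3 \in heis_lie R].
Proof.
by case: hX => hb _ _ _; split; apply: (basis_mem hb); rewrite !inE eqxx ?orbT.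
Qed.

Lemma heis_X3_neq0 : X3 != 0.
Proof.
case: hX => /basis_free fr _ _ _; apply/eqP => X30.
by move: fr; rewrite free_cons => /andP[_]; rewrite free_cons => /andP[_];
  rewrite seq1_free X30 eqxx.
Qed.

Lemma heis_oddP Y : Y \in (<[X1]> + <[X3]>)%VS ->
  exists a c, Y = a *: X1 + c *: X3.
Proof. by move=> /memv_addP[_ /vlineP[a ->] [_ /vlineP[c ->] ->]]; exists a, c. Qed.

Lemma heis_odd_sub Y : Y \in (<[X1]> + <[X3]>)%VS -> Y \in heis_lie R.
Proof.
by case: heis_basis_mem => ? _ ? /heis_oddP[a [c ->]]; rewrite memvD ?memvZ.
Qed.

Lemma heis_ad_odd a c : bracket X2 (a *: X1 + c *: X3) = - a *: X3.
Proof.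
case: hX => _ h12 _ h23.
by rewrite bracketDr !bracketZr h23 bracketC h12 scaler0 addr0 scalerN scaleNr.
Qed.

Lemma heis_ad_odd_mem Y : Y \in (<[X1]> + <[X3]>)%VS ->
  bracket X2 Y \in (<[X1]> + <[X3]>)%VS.
Proof. by case: (heis_grading hX) => _ _ h _; apply: h; exact: memv_line. Qed.

(** Conjugation by [exp X2] acts on [exp g1] through [exp (ad X2)], which is
    [1 + ad X2] since [ad X2] squares to zero. *)
Lemma heis_exp_conj Y : Y \in (<[X1]> + <[X3]>)%VS ->
  nilp_exp X2 *m nilp_exp Y = nilp_exp (Y + bracket X2 Y) *m nilp_exp X2.
Proof.
move=> Y1; have aY1 := heis_ad_odd_mem Y1; case: heis_basis_mem => _ X2h _.
have Yh := heis_odd_sub Y1; have aYh := heis_odd_sub (memvD Y1 aY1).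
rewrite !heis_expM //; congr nilp_exp.
have aa : bracket X2 (bracket X2 Y) = 0.
  case: (heis_oddP Y1) => a [c ->]; rewrite heis_ad_odd.
  by case: hX => _ _ _ h23; rewrite bracketZr h23 scaler0.
rewrite [bracket (Y + _) X2]bracketC bracketDr aa addr0 scalerN.
rewrite [Y + _ + X2]addrAC (addrC X2) -[RHS]addrA; congr (_ + _).
by apply/eqP; rewrite eq_sym subr_eq -scalerDl -div1r -splitr scale1r.
Qed.

Lemma heis_isotropy_fix :
  ltranslate (nilp_exp X2) (connected_subgroup <[X2]>%VS) =
  connected_subgroup <[X2]>%VS.
Proof.
case: heis_basis_mem => _ X2h _.
have eD t : nilp_exp X2 *m nilp_exp (t *: X2) = nilp_exp ((1 + t) *: X2).
  rewrite heis_expM ?memvZ // bracketZr /bracket subrr !scaler0 addr0.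
  by rewrite scalerDl scale1r.
rewrite /ltranslate (heis_subgroupE hX); apply/seteqP; split.
  by move=> _ [_ [t _ <-] <-]; exists (1 + t).
move=> _ [t _ <-]; exists (nilp_exp ((t - 1) *: X2)); first by exists (t - 1).
by rewrite eD addrC subrK.
Qed.

Lemma ltranslateM (A B : 'M[R]_3) S :
  ltranslate (A *m B) S = ltranslate A (ltranslate B S).
Proof.
rewrite /ltranslate image_comp; congr image.
by apply/funext => C; rewrite /= mulmxA.
Qed.

Lemma chart_isotropy m (e : m.-tuple 'M[R]_3) p :
  basis_of (<[X1]> + <[X3]>)%VS e ->
  chart <[X2]>%VS e (p *m (1%:M + ad_mx e X2)) =
  ltranslate (nilp_exp X2) (chart <[X2]>%VS e p).
Proof.
move=> be; rewrite /chart -ltranslateM -!/(frame e _).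
rewrite heis_exp_conj ?(frame_mem be) // ltranslateM heis_isotropy_fix.
by rewrite mulmxDr mulmx1 frameD (ad_mxP be) //; exact: heis_ad_odd_mem.
Qed.

End HeisenbergIsotropy.

Theorem proposition16 (R : realType) (X1 X2 X3 : 'M[R]_3)
    (hX : heis_basis X1 X2 X3) :
  ~ admits_symmetric_metric (@heis_group R) <[X2]>%VS (<[X1]> + <[X3]>)%VS.
Proof.
move=> [m [e [gamma [be [_ sym nondeg] inv]]]].
pose N := ad_mx e X2.
have NP p : frame e (p *m N) = bracket X2 (frame e p).
  by apply: (ad_mxP be) => Y; exact: (heis_ad_odd_mem hX).
have GX2 : heis_group (nilp_exp X2).
  rewrite -heis_exp_range; exists X2 => //=.
  by case: (heis_basis_mem hX).
(* The base point has chart coordinate 0 and is fixed by [exp X2]. *)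
have iso x y : bilin (gamma 0) (x *m (1%:M + N)) (y *m (1%:M + N)) =
    bilin (gamma 0) x y.
  have := inv _ _ GX2 (fun p => chart_isotropy hX p be) 0 x y.
  by rewrite !diff_mulmxr mul0mx.
pose u := coords e X1; pose w := u *m N.
have fu : frame e u = X1.
  by rewrite (coordsK be) // (subvP (addvSl _ _)) // memv_line.
have fw : frame e w = - X3.
  by rewrite NP fu; case: hX => _ h12 _ _; rewrite bracketC h12.
have wN : w *m N = 0.
  apply: (frame_inj be); rewrite NP fw frame0 -scaleN1r bracketZr.
  by case: hX => _ _ _ ->; rewrite scaler0.
have [wu ww] := unipotent_isometry_orth (sym 0) iso wN.
have w0 : w = 0.
  apply: (bilin_nondegenerate (nondeg 0)) => p.
  have [a [c pE]] := heis_oddP (frame_mem be p).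
  have -> : p = a *: u + (- c) *: w.
    apply: (frame_inj be); rewrite frameD !frameZ fu fw pE.
    by rewrite scalerN scaleNr opprK.
  by rewrite bilinDr !bilinZr wu ww !mulr0 addr0.
have := heis_X3_neq0 hX.
by rewrite -oppr_eq0 -fw w0 frame0 eqxx.
Qed.
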